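(* Let $k \geq 2$ be an integer. Then there exists $n_0 = n_0(k)$ such that if $n \geq n_0$ and $\mathcal{F} \subseteq 2^{[n]}$ is an $(n-1)$-trace $k$-Sperner family, then $|\mathcal{F}| \leq \Sigma(n, k-1)$. Furthermore, equality holds if and only if $\mathcal{F} = \mathcal{G}_0$, or $n+k$ is odd and $\mathcal{F} = \mathcal{G}'_0$, where $$\mathcal{G}_0 = \left\{G \in 2^{[n]} : \left\lfloor \tfrac{n-(k-1)}{2} \right\rfloor + 1 \leq |G| \leq \left\lfloor \tfrac{n-(k-1)}{2} \right\rfloor + k - 1\right\},$$ $$\mathcal{G}'_0 = \left\{G \in 2^{[n]} : \left\lfloor \tfrac{n-(k-1)}{2} \right\rfloor \leq |G| \leq \left\lfloor \tfrac{n-(k-1)}{2} \right\rfloor + k - 2\right\}.$$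
   Context: $[n]=\{1,\dots,n\}$ and $2^{[n]}$ is its power set. A chain of length $m$ is a family of $m$ sets $F_1 \subsetneq F_2 \subsetneq \dots \subsetneq F_m$. A family is $k$-Sperner if it contains no chain of length $k+1$. The trace of a family $\mathcal{F}$ on a set $L$ is the family $\mathcal{F}|_L = \{F \cap L : F \in \mathcal{F}\}$ (as a set of sets). A family $\mathcal{F} \subseteq 2^{[n]}$ is $(n-1)$-trace $k$-Sperner if for every $x \in [n]$ the trace $\mathcal{F}|_{[n]\setminus\{x\}}$ is $k$-Sperner. $\Sigma(n,m) = \sum_{i=1}^m \binom{n}{\lfloor \frac{n-m}{2} \rfloor + i}$ denotes the sum of the $m$ largest binomial coefficients of order $n$. *)

(* Defs.v *)
From mathcomp Require Import all_boot.
Set Implicit Arguments.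
Unset Strict Implicit.
Unset Printing Implicit Defensive.

Definition is_chain (T : finType) (C : seq {set T}) : bool :=
  sorted (fun A B : {set T} => A \proper B) C.

Definition sperner (T : finType) (k : nat) (F : {set {set T}}) : Prop :=
  ~ exists C : k.+1.-tuple {set T}, is_chain C /\ {subset C <= F}.

Definition trace (T : finType) (F : {set {set T}}) (L : {set T}) :
    {set {set T}} :=
  [set A :&: L | A in F].

(* The ground set [n] is 'I_n = {0, ..., n-1}. *)
Definition pred_trace_sperner (n k : nat) (F : {set {set 'I_n}}) : Prop :=
  forall x : 'I_n, sperner k (trace F [set~ x]).

(* Natural-number subtraction: the formula is the intended one for m <= n. *)
Definition Sigma (n m : nat) : nat :=
  \sum_(1 <= i < m.+1) 'C(n, (n - m) %/ 2 + i).

(* In G0 and G0', the subtractions agree with the integer ones when k >= 2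
   and n >= k - 1. *)
Definition G0 (n k : nat) : {set {set 'I_n}} :=
  [set G : {set 'I_n} |
    (n - (k - 1)) %/ 2 + 1 <= #|G| <= (n - (k - 1)) %/ 2 + k - 1].

Definition G0' (n k : nat) : {set {set 'I_n}} :=
  [set G : {set 'I_n} |
    (n - (k - 1)) %/ 2 <= #|G| <= (n - (k - 1)) %/ 2 + k - 2].

(* Main.v *)
Require Import Defs.
From mathcomp Require Import all_boot all_fingroup zify.
Set Implicit Arguments.
Unset Strict Implicit.
Unset Printing Implicit Defensive.

(** Let [M] be the part of [F] formed by the sets of size between [2k] and
    [n - 2k].  If [B] is the top of a [k]-chain of [F] and deleting [y] from
    [B] keeps the trace of that chain a chain of length [k], then [B] is the
    only member of [F] strictly above [B \ y].  So a maximal chain through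
    [B \ y] that avoids [B] meets [M] minus the bottoms of its [k]-chains in at
    most [k-2] sets.  For distinct pairs [(B, y)] these maximal chains are
    distinct, and they outnumber at least twofold the maximal chains through
    tops of [k]-chains.  Averaging this count with its complement gives the LYM
    inequality [sum_(A in M) 1/'C(n, |A|) <= k-1], with a loss if [M] has a
    [k]-chain.  A set of [F] outside [M] forces a loss of order [1/poly(n)],
    which exceeds the polynomial contribution of all such sets since the middle
    binomial coefficients are exponential.  So in the case of equality [F = M]
    and every maximal chain meets [F] in exactly [k-1] sets; this leaves the
    levels of [G0], or, when two levels tie, those of [G0']. *)

(** * Exchanging single points within a level *)

Lemma tperm_preim (T : finType) (A : {set T}) (y z : T) :
  y \in A -> z \notin A -> tperm y z @^-1: A = z |: A :\ y.
Proof.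
move=> yA zA; have yz : y != z by apply: contraNneq zA => <-.
apply/setP=> x; rewrite !inE; case: tpermP => [->|->|/eqP xy /eqP xz].
- by rewrite (negPf zA) eqxx (negPf yz).
- by rewrite yA eqxx.
- by rewrite xy (negPf xz).
Qed.

(** Exchanging a point of [A] outside [B] for a point of [B] outside [A] preserves [f] and brings
    [A] closer to [B], hence the induction on [#|A :\: B|]. *)
Lemma eq_on_levels (T : finType) (V : Type) (f : {set T} -> V) :
    (forall (A : {set T}) y z, y \in A -> z \notin A -> f (z |: A :\ y) = f A) ->
  forall A B : {set T}, #|A| = #|B| -> f A = f B.
Proof.
move=> fP A B; move: {2}#|A :\: B| (leqnn #|A :\: B|) => m.
elim: m A => [|m IHm] A leAB eqAB.
  suff -> : A = B by [].
  apply/eqP; rewrite eqEcard eqAB leqnn andbT -setD_eq0 -cards_eq0.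
  by rewrite -leqn0.
have [AB0|[y]] := set_0Vmem (A :\: B).
  by apply: IHm => //; rewrite AB0 cards0.
rewrite inE => /andP[yB yA].
have /card_gt0P[z] : 0 < #|B :\: A|.
  rewrite cardsD setIC -eqAB -cardsD; apply/card_gt0P; exists y.
  by rewrite inE yB.
rewrite inE => /andP[zA zB].
have yz : y != z by apply: contraNneq zA => <-.
rewrite -(fP A y z yA zA); apply: IHm; last first.
  by rewrite cardsU1 !inE (negPf zA) andbF /= add1n -eqAB [in RHS](cardsD1 y A) yA.
rewrite -ltnS; apply: leq_trans leAB; apply: proper_card.
apply/properP; split; last first.
  by exists y; rewrite !inE ?yB ?yA // eqxx (negPf yz).
apply/subsetP=> x; rewrite !inE => /andP[xB /orP[/eqP xz|/andP[_ ->]]].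
  by rewrite xz zB in xB.
by rewrite xB.
Qed.

(** * Maximal chains as permutations, and the LYM weight *)

Section MaximalChains.
Variable n : nat.
Implicit Types (s : {perm 'I_n}) (A B : {set 'I_n}) (G : {set {set 'I_n}}).

Definition prefix_set s i : {set 'I_n} := [set x | s x < i].

(* [s] encodes the maximal chain of its prefix sets. *)
Definition thru s A : bool := A == prefix_set s #|A|.

Lemma card_prefix_set s i : i <= n -> #|prefix_set s i| = i.
Proof.
move=> lein; have -> : prefix_set s i = s @^-1: [set j : 'I_n | j < i].
  by apply/setP=> x; rewrite !inE.
rewrite on_card_preimset; last by apply: onW_bij; apply: injF_bij perm_inj.
rewrite -sum1_card (eq_bigl (fun j : 'I_n => j < i)) => [|j]; last by rewrite inE.
by rewrite (big_ord_narrow lein) sum1_card card_ord.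
Qed.

Lemma thru_prefix s i : i <= n -> thru s (prefix_set s i).
Proof. by move=> lein; rewrite /thru card_prefix_set. Qed.

Lemma card_le_n A : #|A| <= n.
Proof. by rewrite -[X in _ <= X]card_ord max_card. Qed.

Lemma thru_sub s A B : thru s A -> thru s B -> #|A| <= #|B| -> A \subset B.
Proof.
move=> /eqP-> /eqP->; rewrite !card_prefix_set ?card_le_n // => le.
by apply/subsetP=> x; rewrite !inE => lt; apply: leq_trans le.
Qed.

Lemma thru_comparable s A B :
  thru s A -> thru s B -> (A \subset B) || (B \subset A).
Proof.
move=> sA sB; have [le|/ltnW le] := leqP #|A| #|B|.
  by rewrite (thru_sub sA sB).
by rewrite (thru_sub sB sA) // orbT.
Qed.

Lemma card_perm_preim (p : {perm 'I_n}) A : #|p @^-1: A| = #|A|.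
Proof. by rewrite on_card_preimset //; apply: onW_bij; apply: injF_bij perm_inj. Qed.

Lemma prefix_set_perm (p s : {perm 'I_n}) i :
  prefix_set (p * s) i = p @^-1: prefix_set s i.
Proof. by apply/setP=> x; rewrite !inE permM. Qed.

Lemma thru_perm (p s : {perm 'I_n}) A : thru (p * s) (p @^-1: A) = thru s A.
Proof.
rewrite /thru card_perm_preim prefix_set_perm.
apply/eqP/eqP => [/setP eqp|<- //]; apply/setP=> x.
by move: (eqp (p^-1%g x)); rewrite !inE permKV.
Qed.

Definition cnt A := #|[set s | thru s A]|.

Lemma card_perm_mul (p : {perm 'I_n}) (P Q : pred {perm 'I_n}) :
  (forall s, P (p * s)%g = Q s) -> #|[set s | P s]| = #|[set s | Q s]|.
Proof.
move=> PQ; rewrite -[RHS](card_imset _ (mulgI p)); apply: eq_card => s.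
rewrite inE; apply/idP/imsetP => [Ps|[t]]; last first.
  by rewrite inE -PQ => Pt ->.
by exists (p^-1 * s)%g; rewrite ?mulKVg // inE -PQ mulKVg.
Qed.
Lemma cnt_level A B : #|A| = #|B| -> cnt A = cnt B.
Proof.
apply: (eq_on_levels (f := cnt)) => {A B} A y z yA zA.
rewrite -(tperm_preim yA zA); apply: (card_perm_mul (p := tperm y z)) => s.
exact: thru_perm.
Qed.

Lemma thru_level s i : i <= n ->
  [set A : {set _} | (#|A| == i) && thru s A] = [set prefix_set s i].
Proof.
move=> lein; apply/setP=> A; rewrite !inE.
apply/andP/eqP => [[/eqP <- /eqP //]|->].
by rewrite card_prefix_set // thru_prefix.
Qed.

(** By [cnt_bin] this is [n!] times the LYM sum of [1/'C(n, #|A|)] over [G]. *)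
Definition weight G := \sum_(A in G) cnt A.

Lemma weight_perm G : weight G = \sum_s #|[set A in G | thru s A]|.
Proof.
rewrite /weight (eq_bigr (fun A => \sum_s (thru s A : nat))) => [|A _].
  rewrite exchange_big; apply: eq_bigr => s _; rewrite -big_mkcondr /=.
  by rewrite -sum1_card; apply: eq_bigl => A; rewrite inE.
by rewrite -big_mkcond /= sum1_card /cnt cardsE.
Qed.

Lemma card_level (T : finType) i : #|[set A : {set T} | #|A| == i]| = 'C(#|T|, i).
Proof.
rewrite -[#|T|]cardsT -cards_draws; apply: eq_card => A.
by rewrite !inE subsetT.
Qed.

Lemma weight_level i : i <= n -> weight [set A : {set 'I_n} | #|A| == i] = n`!.
Proof.
move=> lein; rewrite weight_perm (eq_bigr (fun=> 1)) => [|s _]; last first.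
  rewrite -(cards1 (prefix_set s i)) -thru_level //.
  by apply: eq_card => B; rewrite !inE.
by rewrite sum1_card card_Sn.
Qed.

(** Each of the [n!] maximal chains meets the level of [A] exactly once, and by symmetry the sets of
    that level share these chains equally. *)
Lemma cnt_bin A : cnt A * 'C(n, #|A|) = n`!.
Proof.
rewrite -(weight_level (card_le_n A)) /weight (eq_bigr (fun=> cnt A)) => [|B].
  by rewrite sum_nat_const card_level card_ord mulnC.
by rewrite inE => /eqP; apply: cnt_level.
Qed.

Lemma cnt_gt0 A : 0 < cnt A.
Proof. by have := fact_gt0 n; rewrite -(cnt_bin A) muln_gt0 => /andP[]. Qed.

Lemma cardsC_n A : #|~: A| = n - #|A|.
Proof. by have := cardsC A; rewrite card_ord; lia. Qed.

Lemma cnt_setC A : cnt (~: A) = cnt A.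
Proof.
have := cnt_bin (~: A); rewrite -(cnt_bin A) cardsC_n bin_sub ?card_le_n // => /eqP.
by rewrite eqn_pmul2r ?bin_gt0 ?card_le_n // => /eqP.
Qed.

Lemma weight_setC G : weight (@setC _ @: G) = weight G.
Proof.
rewrite /weight big_imset /=; last by move=> A B _ _; apply: setC_inj.
by apply: eq_bigr => A _; apply: cnt_setC.
Qed.

Lemma weightID G G' : weight G = weight (G :\: G') + weight (G :&: G').
Proof. by rewrite /weight [LHS](big_setID G') addnC. Qed.

Lemma weight_sub G G' : G \subset G' -> weight G <= weight G'.
Proof. by move=> /setIidPr sub; rewrite (weightID G' G) sub leq_addl. Qed.

Definition cnt_edge B (y : 'I_n) := #|[set s | thru s B && thru s (B :\ y)]|.

Lemma thru_unique s B : B != set0 -> thru s B -> #|[set y in B | thru s (B :\ y)]| = 1.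
Proof.
move=> B0 sB; have cB : 0 < #|B| by rewrite card_gt0.
have ltn : #|B|.-1 < n by rewrite prednK // card_le_n.
(* The last point of [B] in the order given by [s]; positions start at 0, so it stands at
   [#|B| - 1]. *)
pose y0 := (s^-1)%g (Ordinal ltn).
suff -> : [set y in B | thru s (B :\ y)] = [set y0] by rewrite cards1.
have inB x : (x \in B) = (s x < #|B|) by rewrite {1}(eqP sB) inE.
apply/setP=> y; rewrite !inE; apply/andP/eqP => [[yB sBy]|->].
  have cBy : #|B :\ y| = #|B|.-1 by rewrite [in RHS](cardsD1 y) yB.
  apply: (@perm_inj _ s); rewrite permKV; apply: val_inj => /=.
  have : y \notin B :\ y by rewrite !inE eqxx.
  move: yB; rewrite inB (eqP sBy) inE cBy -leqNgt => lt le; apply/eqP.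
  by rewrite eqn_leq le andbT -ltnS prednK.
have yB : y0 \in B by rewrite inB permKV /= prednK.
split=> //; apply/eqP/setP=> x; rewrite !inE inB.
have -> : #|B :\ y0| = #|B|.-1 by rewrite [in RHS](cardsD1 y0) yB.
have -> : (x != y0) = (s x != #|B|.-1 :> nat).
  by rewrite -(inj_eq (@perm_inj _ s)) permKV -(inj_eq val_inj).
by rewrite [RHS]ltn_neqAle -[in RHS]ltnS prednK.

Qed.

(* A maximal chain through [B] passes through [B :\ y] for exactly one
   [y \in B], and transpositions inside [B] make all [y] equally likely. *)
Lemma cnt_edgeE B y : y \in B -> #|B| * cnt_edge B y = cnt B.
Proof.
move=> yB; have B0 : B != set0 by apply/set0Pn; exists y.
rewrite -sum_nat_const.
transitivity (\sum_(x in B) cnt_edge B x).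
  apply: eq_bigr => x xB; apply: (card_perm_mul (p := tperm x y)) => s.
  have E : tperm x y @^-1: B = B.
    by apply/setP=> z; rewrite inE; case: tpermP => // ->; rewrite xB yB.
  have E2 : tperm x y @^-1: (B :\ x) = B :\ y.
    apply/setP=> z; have := E; move=> /setP/(_ z); rewrite !inE => ->; congr (_ && _).
    by rewrite -{2}(tpermR x y) (inj_eq (@perm_inj _ _)).
  have H1 := thru_perm (tperm x y) s B; have H2 := thru_perm (tperm x y) s (B :\ x).
  by rewrite E in H1; rewrite E2 in H2; rewrite H1 H2.
rewrite /cnt_edge /cnt -sum1_card.
transitivity (\sum_(s | thru s B) #|[set x in B | thru s (B :\ x)]|); last first.
  rewrite (eq_bigr (fun=> 1)) => [|s sB]; last by rewrite thru_unique.
  by rewrite sum1_card sum1dep_card.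
rewrite (eq_bigr (fun x => \sum_(s | thru s B) (thru s (B :\ x) : nat))) => [|x _].
  rewrite exchange_big; apply: eq_bigr => s _; rewrite -big_mkcondr /=.
  by rewrite -sum1_card; apply: eq_bigl => A; rewrite inE.
by rewrite -big_mkcondr /= sum1dep_card.
Qed.
End MaximalChains.

(** * Chains as sets of sets, their collapsed points, tops and bottoms *)

Section Chains.
Variable T : finType.
Implicit Types (A B : {set T}) (C G : {set {set T}}).

Definition chainset C : bool :=
  [forall A in C, forall B in C, (A \subset B) || (B \subset A)].

Lemma chainsetP C :
  reflect {in C &, forall A B, (A \subset B) || (B \subset A)} (chainset C).
Proof.
apply: (iffP forall_inP) => [H A B AC BC|H A AC].
  by move/forall_inP: (H A AC); apply.
by apply/forall_inP=> B; apply: H.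
Qed.

Lemma chainset_sub C C' : C \subset C' -> chainset C' -> chainset C.
Proof.
move=> /subsetP sub /chainsetP cC'; apply/chainsetP=> A B AC BC.
by apply: cC'; apply: sub.
Qed.

Lemma chainset_top C B :
  chainset C -> {in C, forall A, A \subset B} -> chainset (B |: C).
Proof.
move=> /chainsetP cC top; apply/chainsetP=> A A'.
rewrite !in_setU1 => /orP[/eqP->|AC] /orP[/eqP->|A'C].
- by rewrite subxx.
- by rewrite top ?orbT.
- by rewrite top.
- exact: cC.
Qed.

(** Passes from tuples to sets: sorting pairwise comparable sets by size gives a strictly increasing
    sequence. *)
Lemma sperner_chainset k G C :
  sperner k G -> chainset C -> C \subset G -> #|C| <= k.
Proof.
move=> spG /chainsetP cC /subsetP CG; rewrite leqNgt; apply/negP=> ltkC; apply: spG.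
pose r (A B : {set T}) := #|A| <= #|B|.
have rtr : transitive r by move=> A B B'; apply: leq_trans.
pose s := sort r (enum C).
have sC : s =i C by move=> A; rewrite mem_sort mem_enum.
have us : uniq s by rewrite sort_uniq enum_uniq.
have ss : sorted r s by apply: sort_sorted => A B; apply: leq_total.
have szs : size (take k.+1 s) == k.+1.
  by rewrite size_takel // size_sort -cardE.
exists (Tuple szs); split; last first.
  by move=> A /mem_take; rewrite sC; apply: CG.
rewrite /is_chain /=; apply: take_sorted.
have : pairwise (fun A B => (A != B) && r A B) s.
  by rewrite pairwise_relI -uniq_pairwise us -sorted_pairwise.
move: sC => /(_ _)/esym sC.
have {sC} : {subset s <= C} by move=> A; rewrite sC.
move=> sC /(pairwise_sorted).
apply: (sub_in_sorted (P := [in C])) => [A B AC BC /andP[nAB leAB]|]; last by apply/allP.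
rewrite properEneq nAB /=; case/orP: (cC A B AC BC) => // BA.
by move: nAB; rewrite eq_sym eqEcard BA [_ <= _]leAB.
Qed.

Lemma chain_max C : chainset C -> 0 < #|C| ->
  exists2 B, B \in C & {in C, forall A, A \subset B}.
Proof.
move=> /chainsetP cC /card_gt0P[A0 A0C].
case: (@arg_maxnP _ A0 [in C] (fun B : {set T} => #|B|) A0C) => B BC Bmax.
exists B => [//|A CA]; case/orP: (cC A B CA BC) => // BA.
by have /eqP<- : B == A by rewrite eqEcard BA; apply: Bmax.
Qed.

Lemma chain_min C : chainset C -> 0 < #|C| ->
  exists2 B, B \in C & {in C, forall A, B \subset A}.
Proof.
move=> /chainsetP cC /card_gt0P[A0 A0C].
case: (@arg_minnP _ A0 [in C] (fun B : {set T} => #|B|) A0C) => B BC Bmin.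
exists B => [//|A CA]; case/orP: (cC A B CA BC) => // AB.
by have /eqP<- : A == B by rewrite eqEcard AB; apply: Bmin.
Qed.

(* The points whose deletion identifies two members, when [C] is a chain. *)
Definition collapsed C : {set T} :=
  [set x | [exists B in C, (x \in B) && (B :\ x \in C)]].

(** Sending [x] to a member [B] with [x \in B] and [B :\ x] in [C] is injective: for one [B], the
    sets [B :\ x] and [B :\ y] are comparable of equal size, hence equal. *)
Lemma card_collapsed C : chainset C -> #|collapsed C| <= #|C|.
Proof.
move=> /chainsetP cC.
pose f x := odflt set0 [pick B in C | (x \in B) && (B :\ x \in C)].
have fP x : x \in collapsed C -> [/\ f x \in C, x \in f x & f x :\ x \in C].
  rewrite inE => /exists_inP[B BC xB]; rewrite /f; case: pickP => [B' /and3P[] //|].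
  by move/(_ B); rewrite BC xB.
rewrite -(card_in_imset (f := f)) => [|x y /fP[_ xfx fxC] /fP[_ yfy fyC] eqf].
  by apply: subset_leq_card; apply/subsetP=> _ /imsetP[x /fP[] ? _ _ ->].
have eqc : #|f x :\ x| = #|f x :\ y|.
  apply: (@addnI 1); rewrite [in RHS]eqf.
  by have := cardsD1 x (f x); have := cardsD1 y (f y); rewrite xfx yfy eqf => <-.
have : f x :\ x = f x :\ y.
  rewrite -eqf in fyC; apply/eqP.
  by case/orP: (cC _ _ fxC fyC) => sub; [|rewrite eq_sym]; rewrite eqEcard sub eqc leqnn.
move/setP/(_ x); by rewrite !inE eqxx xfx /=; case: eqVneq.
Qed.

(** If [A :\ x = B :\ x] with [A] and [B] distinct, just one of them contains [x], and removing [x]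
    from it gives the other, so [x] is collapsed. *)
Lemma collapsed_inj C x : x \notin collapsed C -> {in C &, injective (fun A => A :\ x)}.
Proof.
rewrite inE => /exists_inPn H A B AC BC eqAB.
have agree z : z != x -> (z \in A) = (z \in B).
  by move=> zx; move/setP/(_ z): eqAB; rewrite !inE zx.
have [xA|xA] := boolP (x \in A); have [xB|xB] := boolP (x \in B).
- by apply/setP=> z; have [->|/agree //] := eqVneq z x; rewrite xA xB.
- have := H A AC; rewrite xA eqAB.
  have -> : B :\ x = B by apply/setDidPl; rewrite disjoint_sym disjoints1.
  by rewrite BC.
- have := H B BC; rewrite xB -eqAB.
  have -> : A :\ x = A by apply/setDidPl; rewrite disjoint_sym disjoints1.
  by rewrite AC.
- by apply/setP=> z; have [->|/agree //] := eqVneq z x; rewrite (negPf xA) (negPf xB).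
Qed.

Definition tops k G := [set B in G | [exists C : {set {set T}},
  [&& C \subset G, chainset C, k <= #|C|, B \in C & [forall A in C, A \subset B]]]].

Definition bottoms k G := [set B in G | [exists C : {set {set T}},
  [&& C \subset G, chainset C, k <= #|C|, B \in C & [forall A in C, B \subset A]]]].

Lemma topsP k G B : reflect
  (exists C, [/\ C \subset G, chainset C, k <= #|C|, B \in C &
     {in C, forall A, A \subset B}])
  (B \in tops k G).
Proof.
rewrite inE; apply: (iffP andP) => [[BG /existsP[C]]|].
  by move=> /and5P[CG cC kC BC /forall_inP top]; exists C.
move=> [C [CG cC kC BC top]]; split; first exact: (subsetP CG).
by apply/existsP; exists C; rewrite CG cC kC BC; apply/forall_inP.
Qed.

Lemma bottomsP k G B : reflect
  (exists C, [/\ C \subset G, chainset C, k <= #|C|, B \in C &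
     {in C, forall A, B \subset A}])
  (B \in bottoms k G).
Proof.
rewrite inE; apply: (iffP andP) => [[BG /existsP[C]]|].
  by move=> /and5P[CG cC kC BC /forall_inP top]; exists C.
move=> [C [CG cC kC BC top]]; split; first exact: (subsetP CG).
by apply/existsP; exists C; rewrite CG cC kC BC; apply/forall_inP.
Qed.

Lemma chainset_setC C : chainset (@setC T @: C) = chainset C.
Proof.
apply/chainsetP/chainsetP => cC A B.
  move=> AC BC; have := cC (~: A) (~: B) (imset_f _ AC) (imset_f _ BC).
  by rewrite !setCS orbC.
move=> /imsetP[A' AC ->] /imsetP[B' BC ->]; rewrite !setCS orbC; exact: cC.
Qed.

Lemma setC_imsetK G : @setC T @: (@setC T @: G) = G.
Proof.
rewrite -imset_comp (eq_imset (g := id)) ?imset_id // => A /=; exact: setCK.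
Qed.

Lemma mem_setC_imset G A : (A \in @setC T @: G) = (~: A \in G).
Proof. by rewrite -{1}(setCK A) mem_imset //; apply: setC_inj. Qed.

Lemma tops_setC k G : tops k (@setC T @: G) = @setC T @: bottoms k G.
Proof.
apply/setP=> B; rewrite mem_setC_imset; apply/topsP/bottomsP => [] [C [CG cC kC BC top]].
  exists (@setC T @: C); split.
  - by rewrite -(setC_imsetK G); apply: imsetS.
  - by rewrite chainset_setC.
  - by rewrite card_imset //; apply: setC_inj.
  - by rewrite mem_setC_imset setCK.
  - by move=> A; rewrite mem_setC_imset => /top; rewrite subCset.
exists (@setC T @: C); split.
- exact: imsetS.
- by rewrite chainset_setC.
- by rewrite card_imset //; apply: setC_inj.
- by rewrite mem_setC_imset.
- by move=> A; rewrite mem_setC_imset => /top; rewrite setCS.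
Qed.

Lemma bottoms_setC k G : bottoms k (@setC T @: G) = @setC T @: tops k G.
Proof. by rewrite -{2}(setC_imsetK G) tops_setC setC_imsetK. Qed.

Lemma tops_subset k G : tops k G \subset G.
Proof. by apply/subsetP=> A; rewrite inE => /andP[]. Qed.

Lemma bottoms_subset k G : bottoms k G \subset G.
Proof. by apply/subsetP=> A; rewrite inE => /andP[]. Qed.

Lemma topsS k G G' : G \subset G' -> tops k G \subset tops k G'.
Proof.
move=> sub; apply/subsetP=> B /topsP[C [CG cC kC BC top]]; apply/topsP.
by exists C; split=> //; apply: subset_trans sub.
Qed.
End Chains.

(** * Chains in a family with Sperner traces *)

Section Trace.
Variables (n k : nat) (F : {set {set 'I_n}}).
Hypothesis spF : pred_trace_sperner k F.

Lemma trace_chain (D : {set {set 'I_n}}) x : D \subset F ->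
    {in D &, forall A B, (A :\ x \subset B :\ x) || (B :\ x \subset A :\ x)} ->
    {in D &, injective (fun A => A :\ x)} -> #|D| <= k.
Proof.
move=> /subsetP DF cD injD; rewrite -(card_in_imset injD).
apply: (@sperner_chainset _ k (trace F [set~ x])); first exact: spF.
  by apply/chainsetP=> _ _ /imsetP[A AD ->] /imsetP[B BD ->]; apply: cD.
apply/subsetP=> _ /imsetP[A AD ->]; apply/imsetP; exists A; first exact: DF.
by rewrite setDE.
Qed.

Hypothesis ltkn : k.+1 < n.

(** A chain of [k+1] sets collapses at most [k+1 < n] points, so deleting some other point would
    leave [k+1] sets in a trace. *)
Lemma chain_le (C : {set {set 'I_n}}) : C \subset F -> chainset C -> #|C| <= k.
Proof.
move=> CF cC; rewrite leqNgt; apply/negP=> ltkC.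
have [D DC cD] : exists2 D : {set {set 'I_n}}, D \subset C & #|D| = k.+1.
  have [l [ul sl lC]] : exists l : seq {set 'I_n},
      [/\ uniq l, size l = k.+1 & {subset l <= C}].
    exists (take k.+1 (enum C)); rewrite take_uniq ?enum_uniq // size_takel -?cardE //.
    by split=> // A /mem_take; rewrite mem_enum.
  exists [set A in l]; first by apply/subsetP=> A; rewrite inE => /lC.
  by rewrite cardsE (card_uniqP _).
have {}cC := chainset_sub DC cC.
have /card_gt0P[x] : 0 < #|~: collapsed D|.
  have := card_collapsed cC; have := cardsC (collapsed D); rewrite card_ord; lia.
rewrite inE => xD; suff : #|D| <= k by rewrite cD ltnn.
apply: (trace_chain (x := x) (subset_trans DC CF)).
  by move=> A B AD BD; case/orP: (chainsetP _ cC A B AD BD) => sub;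
    rewrite !(setSD _ sub) ?orbT.
exact: collapsed_inj.
Qed.

(** Deleting [x] keeps [C] a chain with top [B :\ x], below [A :\ x]. Were [A :\ x] different from
    [B :\ x], the trace would have a chain of [k+1] sets. So they agree, and [x \in A] because the
    inclusion is proper. *)
Lemma above_top (B : {set 'I_n}) (C : {set {set 'I_n}}) x (A : {set 'I_n}) :
    C \subset F -> chainset C -> k <= #|C| ->
    B \in C -> {in C, forall A' : {set 'I_n}, A' \subset B} ->
    x \in B -> x \notin collapsed C ->
  A \in F -> B :\ x \proper A -> A = B.
Proof.
move=> CF cC kC BC top xB xC AF pA.
have subx : B :\ x \subset A :\ x by rewrite subsetD1 proper_sub // !inE eqxx.
have subC A' : A' \in C -> A' :\ x \subset A :\ x.
  by move=> /top A'B; apply: subset_trans (setSD _ A'B) subx.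
have agree : A :\ x = B :\ x -> A = B.
  move=> eqAB; have xA : x \in A.
    apply/negPn/negP => nxA; move: pA; rewrite -eqAB properE.
    by rewrite subsetD1 subxx nxA andbF.
  by rewrite -(setD1K xA) eqAB setD1K.
have [AC|AC] := boolP (A \in C).
  by apply: agree; apply/eqP; rewrite eqEsubset subx setSD ?top.
have [/eqP/agree //|neq] := boolP (A :\ x == B :\ x).
have neqC A' : A' \in C -> A' :\ x = A :\ x -> False.
  move=> A'C eqA; have eqB : A' :\ x = B :\ x.
    by apply/eqP; rewrite eqEsubset setSD ?top // eqA subx.
  by rewrite -eqA eqB eqxx in neq.
suff : #|A |: C| <= k by rewrite cardsU1 AC add1n leqNgt ltnS kC.
apply: (trace_chain (x := x)).
- by rewrite subUset sub1set AF.
- move=> A1 A2; rewrite !in_setU1 => /orP[/eqP->|A1C] /orP[/eqP->|A2C].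
  + by rewrite subxx.
  + by rewrite subC ?orbT.
  + by rewrite subC.
  + by case/orP: (chainsetP _ cC _ _ A1C A2C) => sub; rewrite !(setSD _ sub) ?orbT.
- move=> A1 A2; rewrite !in_setU1 => /orP[/eqP->|A1C] /orP[/eqP->|A2C] //.
  + by move/esym/(neqC _ A2C).
  + by move/(neqC _ A1C).
  + exact: (collapsed_inj xC A1C A2C).
Qed.
End Trace.

(** * Maximal chains that skip a top *)

Lemma sum_card_disjoint (I S : finType) (E : {set I}) (Q : I -> {set S}) (R : {set S}) :
    {in E, forall p, Q p \subset R} ->
    {in E &, forall p q s, s \in Q p -> s \in Q q -> p = q} ->
  \sum_(p in E) #|Q p| <= #|R|.
Proof.
move=> QR inj.
have -> : \sum_(p in E) #|Q p| = \sum_(p in E) \sum_(s in R) (s \in Q p : nat).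
  apply: eq_bigr => p pE; rewrite -big_mkcondr /= sum1dep_card.
  by apply: eq_card => s; rewrite !inE andb_idl //; apply: (subsetP (QR p pE)).
rewrite exchange_big -sum1_card /=; apply: leq_sum => s _.
rewrite -big_mkcondr /= sum1dep_card; apply/card_le1_eqP => p q.
by rewrite !inE => /andP[pE sp] /andP[qE sq]; exact: (inj _ _ qE pE s).
Qed.

Section Step.
Variable n : nat.
Implicit Types (s : {perm 'I_n}) (B : {set 'I_n}).

Definition skip B y := [set s | thru s (B :\ y) && ~~ thru s B].

(** A fraction [1/(n - #|B| + 1)] of the chains through [B :\ y] passes through [B], and a fraction
    [1/#|B|] of the chains through [B] passes through [B :\ y]. *)
Lemma card_skip B y : y \in B -> #|B| * #|skip B y| = (n - #|B|) * cnt B.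
Proof.
move=> yB; have cB : #|B| = #|B :\ y|.+1 by rewrite (cardsD1 y) yB.
have leb : #|B| <= n by apply: card_le_n.
have e1 : #|skip B y| = cnt (B :\ y) - cnt_edge B y.
  have -> : skip B y = [set s | thru s (B :\ y)] :\: [set s | thru s B].
    by apply/setP=> s; rewrite !inE andbC.
  rewrite cardsD; congr (_ - _); apply: eq_card => s; rewrite !inE andbC //.
have e2 : (n - #|B|).+1 * cnt_edge B y = cnt (B :\ y).
  apply/eqP; rewrite -(eqn_pmul2r (_ : 0 < 'C(n, #|B :\ y|))); last first.
    by rewrite bin_gt0 card_le_n.
  rewrite cnt_bin -(cnt_bin B) -(cnt_edgeE yB) cB.
  have -> : (n - #|B :\ y|.+1).+1 = n - #|B :\ y| by lia.
  by rewrite mulnAC -mul_bin_left mulnAC.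
rewrite e1 -e2 mulSn addKn -(cnt_edgeE yB); lia.
Qed.
End Step.

Section Half.
Variables (n k : nat) (F M : {set {set 'I_n}}).
Hypothesis spF : pred_trace_sperner k F.
Hypotheses (k1 : 1 < k) (kn : k.+1 < n) (MF : M \subset F).
Hypothesis sizeM : {in M, forall B : {set 'I_n},
  k < #|B| /\ 2 * #|B| <= (#|B| - k) * (n - #|B|)}.

Let M' := M :\: bottoms k M.
Let hits (s : {perm 'I_n}) := [set A in M' | thru s A].

Lemma chainset_thru (s : {perm 'I_n}) (G : {set {set 'I_n}}) :
  chainset [set A in G | thru s A].
Proof.
apply/chainsetP=> A B; rewrite !inE => /andP[_ sA] /andP[_ sB].
exact: thru_comparable sA sB.
Qed.

(** The least set of a longer chain would be a bottom of [M], and those were removed. *)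
Lemma card_without_bottoms (D : {set {set 'I_n}}) :
  D \subset M' -> chainset D -> #|D| <= k.-1.
Proof.
move=> DM cD; rewrite leqNgt; apply/negP=> ltD.
have leD : k <= #|D| by lia.
have [|m mD min] := chain_min cD; first by lia.
have : m \in bottoms k M.
  by apply/bottomsP; exists D; split=> //; apply: subset_trans DM (subsetDl _ _).
by move/subsetP: DM => /(_ m mD); rewrite inE => /andP[/negP].
Qed.

(** By [above_top] every set of [hits s] lies inside [B :\ y]. If there were [k-1] of them, adding
    [B] would give a [k]-chain of [M] whose least set is a bottom, yet belongs to [M']. *)
Lemma hits_skip (B : {set 'I_n}) (C : {set {set 'I_n}}) (y : 'I_n) s :
    C \subset F -> chainset C -> k <= #|C| -> B \in C ->
    {in C, forall A : {set 'I_n}, A \subset B} -> y \in B -> y \notin collapsed C ->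
  B \in M -> s \in skip B y -> #|hits s| <= k.-2.
Proof.
move=> CF cC kC BC top yB yC BM; rewrite inE => /andP[sBy sB].
have DB : {in hits s, forall A : {set 'I_n}, A \subset B :\ y}.
  move=> A; rewrite !inE => /andP[/andP[_ AM] sA].
  have [//|nsub] := boolP (A \subset B :\ y).
  have := thru_comparable sA sBy; rewrite (negPf nsub) /= => sub.
  have eqAB : A = B.
    apply: (above_top spF CF cC kC BC top yB yC); first exact: (subsetP MF).
    by rewrite properE sub.
  by rewrite -eqAB sA in sB.
have BD : B \notin hits s.
  by apply/negP=> /DB /subsetP/(_ y yB); rewrite !inE eqxx.
rewrite leqNgt; apply/negP=> ltD.
have cD := chainset_thru s M' : chainset (hits s).
have [|m mD min] := chain_min cD; first by lia.
have mM : m \in M by move: mD; rewrite !inE => /andP[/andP[]].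
have : m \in bottoms k M.
  apply/bottomsP; exists (B |: hits s); split.
  - rewrite subUset sub1set BM; apply/subsetP=> A; rewrite !inE.
    by case/andP=> /andP[].
  - by apply: chainset_top => // A /DB; move/subset_trans; apply; apply: subD1set.
  - by rewrite cardsU1 BD; lia.
  - by rewrite in_setU1 mD orbT.
  - move=> A; rewrite in_setU1 => /orP[/eqP->|]; last exact: min.
    exact: subset_trans (DB m mD) (subD1set _ _).
by move: mD; rewrite !inE => /andP[/andP[/negP]].
Qed.

Let misses := [set s | #|hits s| <= k.-2].

Lemma weight_misses : weight M' + #|misses| <= k.-1 * n`!.
Proof.
rewrite weight_perm -sum1_card [X in _ + X](big_mkcond) /= -big_split /=.
have -> : k.-1 * n`! = \sum_(s : {perm 'I_n}) k.-1.
  by rewrite sum_nat_const card_Sn mulnC.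
apply: leq_sum => s _; rewrite inE -/(hits s).
have : #|hits s| <= k.-1.
  apply: card_without_bottoms; last exact: chainset_thru.
  by apply/subsetP=> A; rewrite inE => /andP[].
by rewrite -/(hits s); move: #|hits s| => m; case: ifP; lia.
Qed.

(** By [hits_skip] and [above_top], the sets [skip B y], with [y \in B] not collapsed by a fixed
    chain [ch B], lie in [misses] and are disjoint. There are at least [#|B| - k] such [y], so by
    [card_skip] and [sizeM] they contribute at least [2 * cnt B] for each [B]. *)
Lemma weight_tops : 2 * weight (tops k F :&: M) <= #|misses|.
Proof.
pose P B (C : {set {set 'I_n}}) :=
  [&& C \subset F, chainset C, k <= #|C|, B \in C & [forall A in C, A \subset B]].
pose ch B := odflt set0 [pick C | P B C].
have chP B : B \in tops k F -> P B (ch B).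
  rewrite inE => /andP[_ /existsP[C PC]]; rewrite /ch.
  by case: pickP => // /(_ C); rewrite /P PC.
pose good B := B :\: collapsed (ch B).
pose E := [set p : {set 'I_n} * 'I_n | (p.1 \in tops k F :&: M) && (p.2 \in good p.1)].
have sumE : \sum_(p in E) #|skip p.1 p.2| <= #|misses|.
  apply: sum_card_disjoint; first move=> [B y].
    rewrite inE /= => /andP[/setIP[/chP/and5P[CF cC kC BC /forall_inP top] BM]].
    move=> /setDP[yB yC].
    by apply/subsetP=> s sQ; rewrite inE; apply: (hits_skip CF cC kC BC top yB yC BM).
  move=> [B y] [B1 y1]; rewrite inE /= => /andP[/setIP[BT BM] /setDP[yB yC]].
  rewrite inE /= => /andP[/setIP[BT1 BM1] /setDP[yB1 yC1]] s.
  rewrite !inE => /andP[sB _] /andP[sB1 _].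
  wlog sub : B y B1 y1 BT BM yB yC BT1 BM1 yB1 yC1 sB sB1 / B :\ y \subset B1 :\ y1.
    move=> W; case/orP: (thru_comparable sB sB1) => sub; first exact: W.
    by apply/esym; apply: W.
  case/and5P: (chP B BT) => CF cC kC BC /forall_inP top.
  (* [B1] contains [B1 :\ y1] properly, so it is strictly above [B :\ y], where [B] is the only
     member of [F]. *)
  have eqB : B1 = B.
    apply: (above_top spF CF cC kC BC top yB yC); first exact: (subsetP MF).
    by apply: sub_proper_trans sub _; rewrite properD1.
  subst B1; congr (_, _); apply/eqP/negPn/negP=> neq.
  by move/subsetP: sub => /(_ y1); rewrite !inE eqxx yB1 eq_sym neq => /(_ isT).
apply: leq_trans sumE.
rewrite (eq_bigl (fun p => (p.1 \in tops k F :&: M) && (p.2 \in good p.1))); last first.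
  by move=> p; rewrite inE.
rewrite -(pair_big_dep (fun B => B \in tops k F :&: M) (fun B y => y \in good B)
   (fun B y => #|skip B y|)) /= /weight big_distrr /=.
apply: leq_sum => B /setIP[BT BM].
have [ltk big] := sizeM BM.
case/and5P: (chP B BT) => CF cC kC BC _.
have b0 : 0 < #|B| by lia.
rewrite -(leq_pmul2l b0) big_distrr /=.
rewrite (eq_bigr (fun=> (n - #|B|) * cnt B)) => [|y /setDP[yB _]]; last exact: card_skip.
rewrite sum_nat_const mulnCA mulnA mulnA leq_mul2r (leq_trans big) ?orbT //.
rewrite leq_mul2r; apply/orP; right.
have := card_collapsed cC; have := chain_le spF kn CF cC.
have := subset_leq_card (subsetIr B (collapsed (ch B))).
rewrite /good cardsD; move=> le1 le2 le3.
exact: leq_sub2l (leq_trans le1 (leq_trans le3 le2)).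
Qed.

(** [N] counts [misses]. A maximal chain through [S] is in [misses], or it carries [k-1] sets of [M]
    above [S]; with [S] these form a [k]-chain of [F], whose top lies in [M]. Hence [cnt S] is at
    most [N + N/2]. *)
Lemma chain_deficit : exists N,
  [/\ weight M' + N <= k.-1 * n`!, 2 * weight (tops k F :&: M) <= N &
      forall S : {set 'I_n}, S \in F ->
        {in M, forall B : {set 'I_n}, #|S| < #|B|} -> cnt S <= 2 * N].
Proof.
exists #|misses|; split; [exact: weight_misses|exact: weight_tops|].
move=> S SF small; apply: (@leq_trans (#|misses| + weight (tops k F :&: M))); last first.
  have := weight_tops; lia.
rewrite weight_perm /cnt -!sum1_card [X in X <= _]big_mkcond.
rewrite [X in _ <= X + _]big_mkcond -big_split /=; apply: leq_sum => s _; rewrite !inE.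
case: ifP => // sS; case: (leqP #|hits s| k.-2) => //= lt.
pose D := [set A in M | thru s A].
have leD : #|hits s| <= #|D|.
  by apply: subset_leq_card; apply/subsetP=> A; rewrite !inE => /andP[/andP[_ ->]].
have cD : chainset D := chainset_thru s M.
have ltD : k.-2 < #|D| := leq_trans lt leD.
have [|B BD top] := chain_max cD; first exact: leq_ltn_trans ltD.
have /andP[BM sB] : (B \in M) && thru s B by move: BD; rewrite inE.
rewrite add0n; apply/card_gt0P; exists B; rewrite !inE sB BM !andbT.
suff : B \in tops k F by rewrite inE.
apply/topsP; exists (S |: D); split.
- rewrite subUset sub1set SF; apply/subsetP=> A; rewrite inE => /andP[AM _].
  exact: (subsetP MF).
- apply: chainset_sub (chainset_thru s (S |: M)).
  apply/subsetP=> A; rewrite !inE => /orP[/eqP->|/andP[-> ->]].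
    by rewrite eqxx sS.
  by rewrite orbT.
- suff SD : S \notin D by rewrite cardsU1 SD add1n; move: ltD; move: #|D| => m; lia.
  by apply/negP; rewrite inE => /andP[/small]; rewrite ltnn.
- by rewrite in_setU1 BD orbT.
- move=> A; rewrite in_setU1 => /orP[/eqP->|]; last exact: top.
  by apply: thru_sub sS sB _; apply/ltnW/small.
Qed.
End Half.

(** * Complementation and the LYM inequality with loss *)

Lemma pred_trace_sperner_setC n k (F : {set {set 'I_n}}) :
  pred_trace_sperner k F -> pred_trace_sperner k (@setC _ @: F).
Proof.
move=> spF x [C [cC CF]]; apply: (spF x).
(* Complementing inside the punctured ground set matches the two traces and reverses inclusion. *)
pose g (A : {set 'I_n}) := [set~ x] :\: A.
have gF A : A \in C -> g A \in trace F [set~ x].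
  move=> /CF/imsetP[A0]; rewrite mem_setC_imset => A0F ->.
  apply/imsetP; exists (~: A0) => //.
  by rewrite /g setDIr setDv setU0 setDE setIC.
exists [tuple of rev (map g C)]; split; last first.
  by move=> A; rewrite mem_rev => /mapP[B BC ->]; apply: gF.
rewrite /is_chain /= rev_sorted sorted_map.
have CL : {in C, forall A : {set 'I_n}, A \subset [set~ x]}.
  by move=> A /CF/imsetP[A0 _ ->]; apply: subsetIr.
move: cC; apply: (@sub_in_sorted _ [in C]); last by apply/allP.
move=> A B AC BC /= pAB; have [sAB [y yB yA]] := properP pAB.
apply/properP; split; first exact: setDS.
exists y; rewrite !inE ?yA ?yB //=.
by have := subsetP (CL _ BC) y yB; rewrite !inE.
Qed.

Lemma setC_imsetD (T : finType) (G G' : {set {set T}}) :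
  (@setC T @: G) :\: (@setC T @: G') = @setC T @: (G :\: G').
Proof. by apply/setP=> A; rewrite !(mem_setC_imset, inE). Qed.

Lemma setC_imsetI (T : finType) (G G' : {set {set T}}) :
  (@setC T @: G) :&: (@setC T @: G') = @setC T @: (G :&: G').
Proof. by apply/setP=> A; rewrite !(mem_setC_imset, inE). Qed.

Section Deficit.
Variables (n k : nat) (F : {set {set 'I_n}}).
Hypothesis spF : pred_trace_sperner k F.
Hypotheses (k1 : 1 < k) (kn : 4 * k < n).

(** The margin [2k] gives [b - k >= b/2] and [n - b >= 4] for each size [b], which yields [sizeM];
    it is symmetric, so the complements qualify too. *)
Definition middle : {set {set 'I_n}} := [set A in F | 2 * k <= #|A| <= n - 2 * k].
Local Notation M := middle.

Lemma middle_sub : M \subset F.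
Proof. by apply/subsetP=> A; rewrite inE => /andP[]. Qed.

(** [chain_deficit] for [F] bounds [M] without its bottoms, and for the complements [M] without its
    tops. Adding both, the removed weights cost at most [(N1 + N2)/2], so half of the gain [N1 + N2]
    survives. [S] is treated in [F] if it is small and through its complement if it is large. *)
Lemma middle_deficit : exists N1 N2,
  [/\ 4 * weight M + (N1 + N2) <= 4 * (k.-1 * n`!),
      2 * weight (tops k F :&: M) <= N1 &
      {in F :\: M, forall S : {set 'I_n}, cnt S <= 2 * (N1 + N2)}].
Proof.
have size b : 2 * k <= b <= n - 2 * k -> k < b /\ 2 * b <= (b - k) * (n - b).
  by move=> /andP[? ?]; split; nia.
have [|||N1 [W1 T1 S1]] := @chain_deficit n k F M spF k1; first lia.
- exact: middle_sub.
- by move=> B; rewrite inE => /andP[_]; apply: size.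
have := @chain_deficit n k (@setC _ @: F) (@setC _ @: M) (pred_trace_sperner_setC spF) k1.
case; first lia.
- exact: imsetS middle_sub.
- move=> B; rewrite mem_setC_imset inE => /andP[_ sB].
  by apply: size; move: sB; rewrite cardsC_n; have := card_le_n B; lia.
move=> N2 []; rewrite bottoms_setC tops_setC setC_imsetD setC_imsetI !weight_setC => W2 T2 S2.
have T1' : weight (tops k M) <= weight (tops k F :&: M).
  by apply: weight_sub; rewrite subsetI topsS ?middle_sub // tops_subset.
have T2' : weight (bottoms k M) <= weight (bottoms k F :&: M).
  rewrite -!(weight_setC (bottoms _ _)) -(weight_setC (_ :&: _)) -setC_imsetI -!tops_setC.
  by apply: weight_sub; rewrite subsetI topsS ?imsetS ?middle_sub // tops_subset.
have E1 := weightID M (tops k M); have E2 := weightID M (bottoms k M).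
rewrite (setIidPr (tops_subset k M)) in E1.
rewrite (setIidPr (bottoms_subset k M)) in E2.
exists N1, N2; split=> //; first lia.
move=> S /setDP[SF]; rewrite inE SF /= => nS.
have [lt|ge] := ltnP #|S| (2 * k).
  apply: (@leq_trans (2 * N1)); last lia.
  by apply: S1 => // B; rewrite inE => /andP[_ /andP[le _]]; apply: leq_trans lt le.
rewrite ge /= in nS.
apply: (@leq_trans (2 * N2)); last lia.
rewrite -cnt_setC; apply: S2; first by rewrite mem_setC_imset setCK.
have arith s b : ~~ (s <= n - 2 * k) -> 2 * k <= n - b <= n - 2 * k -> s <= n ->
  n - s < b by lia.
move=> B; rewrite mem_setC_imset inE !cardsC_n => /andP[_ sB].
exact: arith nS sB (card_le_n S).
Qed.

Lemma middle_weight : weight M <= k.-1 * n`!.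
Proof. have [N1 [N2 [W _ _]]] := middle_deficit; lia. Qed.

Lemma outside_deficit S : S \in F :\: M -> 8 * weight M + cnt S <= 8 * (k.-1 * n`!).
Proof. have [N1 [N2 [W _ H]]] := middle_deficit; move/H; lia. Qed.

(** Equality forces [N1 = 0], so [M] has no top of a [k]-chain and each maximal chain meets [M] at
    most [k-1] times; the average being [k-1], all of them attain it. *)
Lemma middle_tight (s : {perm 'I_n}) : F = M -> weight M = k.-1 * n`! ->
  #|[set A in M | thru s A]| = k.-1.
Proof.
move=> eqF eqW; have [N1 [N2 [W T _]]] := middle_deficit.
have T0 : tops k M = set0.
  apply/eqP/set0Pn=> -[B BT].
  have : weight (tops k F :&: M) = 0 by lia.
  move/eqP; rewrite /weight sum_nat_eq0 => /forall_inP/(_ B).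
  have BM : B \in M by move: BT; rewrite inE => /andP[].
  rewrite inE {1}eqF BT BM => /(_ isT); have := cnt_gt0 B; lia.
have le (t : {perm 'I_n}) : #|[set A in M | thru t A]| <= k.-1.
  rewrite leqNgt; apply/negP=> lt; have cD := chainset_thru t M.
  have [|B BD top] := chain_max cD; first by apply: leq_ltn_trans lt.
  suff : B \in tops k M by rewrite T0 inE.
  apply/topsP; exists [set A in M | thru t A]; split=> //.
    by apply/subsetP=> A; rewrite inE => /andP[].
  by apply: leq_trans lt; lia.
move: eqW; rewrite weight_perm.
have -> : k.-1 * n`! = \sum_(t : {perm 'I_n}) k.-1 by rewrite sum_nat_const card_Sn mulnC.
move/eqP; have := leqif_sum (fun t (_ : true) => leqif_eq (le t)).
by case=> _ -> /forallP/(_ s)/eqP.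
Qed.
End Deficit.

(** * Binomial and exponential estimates *)

Lemma ltn_bin n i j : i < j -> i + j < n -> 'C(n, i) < 'C(n, j).
Proof.
have step l : 2 * l + 1 < n -> 'C(n, l) < 'C(n, l.+1).
  move=> ltl; rewrite -(ltn_pmul2l (ltn0Sn l)) mul_bin_left ltn_pmul2r; first lia.
  by rewrite bin_gt0; lia.
have mono l d : 2 * (l + d) + 1 < n -> 'C(n, l) < 'C(n, l + d.+1).
  elim: d => [|d IHd] le; first by rewrite addn1; apply: step; lia.
  by rewrite addnS; apply: ltn_trans (IHd _) _; rewrite ?step //; lia.
move=> ij ijn; have [le|gt] := leqP (2 * j) n.
  have := mono i (j - i).-1; have -> : i + (j - i).-1.+1 = j by lia.
  by apply; lia.
(* Past the middle, [j] is reflected to [n - j], which still exceeds [i]. *)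
rewrite -[X in _ < X]bin_sub; last lia.
have := mono i (n - j - i).-1; have -> : i + (n - j - i).-1.+1 = n - j by lia.
by apply; lia.
Qed.

Lemma leq_exp2_bin n i : 2 * i <= n -> 2 ^ i <= 'C(n, i).
Proof.
elim: i n => [|i IHi] n lein; first by rewrite bin0.
case: n lein => [|[|n]] lein; [lia|lia|].
by rewrite !binS expnS; have := IHi n; have := leq_bin2l i (leqnSn n); lia.
Qed.

Lemma leq_bin_exp n i : 'C(n, i) <= n ^ i.
Proof.
elim: i => [|i IHi]; first by rewrite bin0.
have := mul_bin_left n i; rewrite expnS; nia.
Qed.

Lemma poly_lt_exp C d : exists N, forall e, N <= e -> C * e.+1 ^ d < 2 ^ e.
Proof.
(* This threshold makes [q >= C * (d+1)^d], so that [C * ((d+1)(q+1))^d < (q+1)^(d+1) <= 2^(q(d+1))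
   <= 2^e]. *)
exists (C * d.+1 ^ d * d.+1) => e le; set q := e %/ d.+1.
have leq : C * d.+1 ^ d <= q by rewrite leq_divRL.
have lte : e < d.+1 * q.+1 by rewrite mulnC ltn_ceil.
apply: (@leq_trans (q.+1 ^ d.+1)).
  apply: (@leq_ltn_trans (C * (d.+1 * q.+1) ^ d)).
    rewrite leq_mul2l; apply/orP; right.
    by case: (posnP d) => [->|d0]; rewrite ?expn0 ?leq_exp2r.
  by rewrite expnMn mulnA expnS ltn_pmul2r ?expn_gt0.
apply: (@leq_trans ((2 ^ q) ^ d.+1)); first by rewrite leq_exp2r // ltn_expl.
by rewrite -expnM leq_exp2l // leq_trunc_div.
Qed.

Lemma card_small_sets (T : finType) j : 0 < #|T| ->
  #|[set A : {set T} | #|A| < j]| <= j * #|T| ^ j.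
Proof.
move=> T0; elim: j => [|j IHj].
  by rewrite leqn0 cards_eq0; apply/eqP/setP=> A; rewrite !inE.
have -> : [set A : {set T} | #|A| < j.+1] =
    [set A : {set T} | #|A| < j] :|: [set A : {set T} | #|A| == j].
  by apply/setP=> A; rewrite !inE ltnS leq_eqVlt orbC.
apply: leq_trans (leq_card_setU _ _) _; rewrite card_level.
apply: (@leq_trans (j.+1 * #|T| ^ j)); last by rewrite leq_mul2l leq_pexp2l ?orbT.
by rewrite mulSn addnC leq_add ?leq_bin_exp.
Qed.

(** * The middle levels and the tie between two levels *)

Section MiddleLevels.
Variables n k : nat.
Hypotheses (k1 : 1 < k) (kn : 4 * k < n).
Local Notation a := ((n - (k - 1)) %/ 2).
Local Notation m := (a + k - 1).
Local Notation G := (G0 n k).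

Lemma mem_G0 A : (A \in G) = (a < #|A| <= m).
Proof. by rewrite inE addn1. Qed.

Lemma sum_G0 (f : {set 'I_n} -> nat) :
  \sum_(A in G) f A = \sum_(1 <= i < k) \sum_(A : {set 'I_n} | #|A| == a + i) f A.
Proof.
rewrite (exchange_big_dep xpredT) //= big_mkcond; apply: eq_bigr => A _.
rewrite mem_G0; move: #|A| => x.
have [le|gt] := leqP a x; last first.
  rewrite (_ : a < x = false) /=; last lia.
  by rewrite big_pred0 // => i; lia.
rewrite (eq_bigl (fun i => i == x - a)); last by move=> i; lia.
by rewrite big_nat1_eq; congr (if _ then _ else _); lia.
Qed.

Lemma card_G0 : #|G| = Sigma n (k - 1).
Proof.
rewrite -sum1_card sum_G0 /Sigma (_ : (k - 1).+1 = k); last lia.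
by apply: eq_bigr => i _; rewrite sum1dep_card card_level card_ord.
Qed.

Lemma weight_G0 : weight G = k.-1 * n`!.
Proof.
rewrite /weight sum_G0 (eq_big_nat _ _ (F2 := fun=> n`!)) => [|i ik].
  by rewrite sum_nat_const_nat; lia.
rewrite -(@weight_level n (a + i)); last lia.
by apply: eq_bigl => A; rewrite inE.
Qed.

(** [a] is rounded down. In the first case, [n + k] odd, levels [a] and [m] mirror each other and
    tie; in the second, level [m] mirrors level [a + 1]. *)
Lemma n_cases : n = m + a \/ n = m + a.+1.
Proof. lia. Qed.

Lemma bin_sub_m : 'C(n, m) = 'C(n, n - m).
Proof. by rewrite bin_sub //; case: n_cases; lia. Qed.

Lemma bin_inside x : a < x <= m ->
  'C(n, m) <= 'C(n, x) ?= iff ((x == m) || (x == n - m)).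
Proof.
move=> /andP[ax xm]; apply/leqifP.
have [->|nm] := eqVneq x m; first by rewrite eqxx.
have [->|nm'] := eqVneq x (n - m); first by rewrite bin_sub_m eqxx.
rewrite bin_sub_m /=; apply: ltn_bin; case: n_cases => ?; lia.
Qed.

Lemma bin_outside x : x <= n -> ~~ (a < x <= m) ->
  'C(n, x) <= 'C(n, m) ?= iff ((x == a) && (n == m + a)).
Proof.
move=> xn nx; apply/leqifP; have am : a < m by lia.
have [xa|ax] := leqP x a.
  case: ifP => [/andP[/eqP-> /eqP en]|ne].
    by rewrite bin_sub_m (_ : n - m = a) //; lia.
  by rewrite bin_sub_m; apply: ltn_bin; case: n_cases => en; lia.
rewrite ax -ltnNge /= in nx.
rewrite (_ : x == a = false) /=; last lia.
by rewrite bin_sub_m -(bin_sub xn); apply: ltn_bin; case: n_cases => ?; lia.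
Qed.

Lemma exp2_leq_bin : 2 ^ a <= 'C(n, m).
Proof.
apply: (@leq_trans 'C(n, a)); first by apply: leq_exp2_bin; lia.
rewrite bin_sub_m; case: n_cases => en; first by rewrite (_ : n - m = a) //; lia.
by apply/ltnW/ltn_bin; lia.
Qed.

(* Sets outside the middle levels weigh at least [n`! / 'C(n, m)], sets inside
   at most that, so replacing the former by the latter is favourable. *)
Lemma exchange_G0 (M : {set {set 'I_n}}) :
  #|M| * n`! + 'C(n, m) * weight G <= #|G| * n`! + 'C(n, m) * weight M
  ?= iff [forall A, (A \in M) (+) (A \in G) ==> ('C(n, #|A|) == 'C(n, m))].
Proof.
have E (X Y : {set {set 'I_n}}) : #|X| * n`! + 'C(n, m) * weight Y =
    \sum_A ((A \in X) * n`! + (A \in Y) * ('C(n, m) * cnt A)).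
  rewrite big_split /=; congr (_ + _).
    by rewrite -big_distrl /= -sum1_card big_mkcond.
  rewrite /weight big_distrr big_mkcond; apply: eq_bigr => A _ /=.
  by case: (A \in Y); rewrite ?mul1n ?mul0n.
rewrite !E; apply: leqif_sum => A _; rewrite -(cnt_bin A) ![cnt A * _]mulnC.
have cA := cnt_gt0 A.
have [|] := boolP (A \in G); rewrite mem_G0.
  move/bin_inside=> [le _]; case: (A \in M); rewrite /= ?mul1n ?mul0n ?add0n ?addn0.
    by rewrite addnC; apply/leqif_refl.
  by split; rewrite ?eqn_pmul2r ?leq_pmul2r // eq_sym.
move/(bin_outside (card_le_n A))=> [le _]; case: (A \in M).
  by rewrite /= ?mul1n ?mul0n ?add0n ?addn0; split; rewrite ?eqn_pmul2r ?leq_pmul2r.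
exact/leqif_refl.
Qed.

Lemma hits_G0 (s : {perm 'I_n}) : #|[set A in G | thru s A]| = k.-1.
Proof.
transitivity (\sum_(A in G) (thru s A : nat)).
  by rewrite -big_mkcondr /= sum1dep_card.
rewrite sum_G0 (eq_big_nat _ _ (F2 := fun=> 1)) => [|i ik].
  by rewrite sum_nat_const_nat; lia.
rewrite -big_mkcondr /= sum1dep_card -[RHS](cards1 (prefix_set s (a + i))).
rewrite -thru_level; last lia.
by apply: eq_card => A; rewrite !inE.
Qed.

Section Tie.
Variable F : {set {set 'I_n}}.
Hypothesis ena : n = m + a.
Hypothesis hitsF : forall s : {perm 'I_n}, #|[set A in F | thru s A]| = k.-1.
Hypothesis missed : forall A, A \in G -> A \notin F -> #|A| = m.
Hypothesis extra : forall A, A \in F -> A \notin G -> #|A| = a.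

(** Along [s], the families [F] and [G] can differ only at levels [a] and [m]. Both have [k-1] sets
    there and [G] has just the one at level [m], so [F] has exactly one of the two. *)
Lemma bottom_xor_top (s : {perm 'I_n}) :
  (prefix_set s a \in F) = (prefix_set s m \notin F).
Proof.
have an : a <= n by lia. have mn : m <= n by lia.
set A := prefix_set s a; set B := prefix_set s m.
have cA : #|A| = a by apply: card_prefix_set.
have cB : #|B| = m by apply: card_prefix_set.
have AG : A \notin G by rewrite mem_G0 cA ltnn.
have BG : B \in G by rewrite mem_G0 cB leqnn andbT; lia.
have AB : B != A by apply: contraNneq AG => <-.
have sA : thru s A by apply: thru_prefix.
have sB : thru s B by apply: thru_prefix.
have uA X : thru s X -> #|X| = a -> X = A by move=> /eqP sX cX; rewrite sX cX.
have uB X : thru s X -> #|X| = m -> X = B by move=> /eqP sX cX; rewrite sX cX.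
have inH (Y : {set {set 'I_n}}) X :
    (X \in [set A in Y | thru s A]) = (X \in Y) && thru s X.
  by rewrite inE.
have := hitsF s; rewrite (cardsD1 A) (cardsD1 B).
have -> : [set X in F | thru s X] :\ A :\ B = [set X in G | thru s X] :\ B.
  apply/setP=> X; rewrite !in_setD1 !inH.
  have [//|XB] := eqVneq X B; have [sX|] := boolP (thru s X); last by rewrite !andbF.
  rewrite !andbT /=; have [->|XA] := eqVneq X A; first by rewrite (negPf AG).
  have [XF|XF] := boolP (X \in F); have [XG|XG] := boolP (X \in G) => //.
    by move: XA; rewrite (uA X sX (extra XF XG)) eqxx.
  by move: XB; rewrite (uB X sX (missed XG XF)) eqxx.
rewrite -(hits_G0 s) [in RHS](cardsD1 B) in_setD1 !inH AB BG sA sB !andbT.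
by case: (A \in F); case: (B \in F) => /=; move: #|_ :\ _| => x; lia.
Qed.

(** Take a maximal chain through [A] with [z] among its first [m] points. Swapping [y] and [z]
    changes its set at level [a] but not the one at level [m], so [bottom_xor_top] transfers
    membership. *)
Lemma bottom_swap (A : {set 'I_n}) y z : #|A| = a -> y \in A -> z \notin A ->
  (z |: A :\ y \in F) = (A \in F).
Proof.
move=> cA yA zA; have am : a < m by lia.
have [s sA sz] : exists2 s : {perm 'I_n}, thru s A & s z < m.
  have /card_gt0P[s] := cnt_gt0 A; rewrite inE => sA.
  have an : a < n by lia.
  (* [w] is the first point after [A]; exchanging it with [z] puts [z] at position [a < m] and
     leaves [A] fixed. *)
  pose w := (s^-1)%g (Ordinal an); exists (tperm z w * s)%g; last first.
    by rewrite permM tpermL permKV.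
  have wA : w \notin A by rewrite (eqP sA) inE permKV cA ltnn.
  suff <- : tperm z w @^-1: A = A by rewrite thru_perm.
  apply/setP=> x; rewrite inE; case: tpermP => // ->.
    by rewrite (negPf wA) (negPf zA).
  by rewrite (negPf wA) (negPf zA).
have eA : A = prefix_set s a by rewrite {1}(eqP sA) cA.
have sy : s y < m by move: yA; rewrite eA inE => /ltn_trans; apply.
have := bottom_xor_top (tperm y z * s); rewrite !prefix_set_perm -eA tperm_preim // => ->.
rewrite eA bottom_xor_top; congr (_ \notin F); apply/setP=> x; rewrite !inE.
by case: tpermP => // ->; rewrite sy sz.
Qed.

Lemma bottom_level_const (A B : {set 'I_n}) :
  #|A| = a -> #|B| = a -> (A \in F) = (B \in F).
Proof.
(* The size test makes [f] invariant under exchanges on every level, as [eq_on_levels] demands. *)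
move=> cA cB; pose f (X : {set 'I_n}) := (#|X| == a) && (X \in F).
suff : f A = f B by rewrite /f cA cB eqxx.
apply: eq_on_levels; last by rewrite cA.
move=> X y z yX zX; rewrite /f.
have -> : #|z |: X :\ y| = #|X|.
  by rewrite -(tperm_preim yX zX) card_perm_preim.
by case: eqP => //= cX; rewrite bottom_swap.
Qed.

(** [F] contains all of level [a] or none of it. In the first case it avoids level [m] and is [G0'];
    in the second it lies inside [G] and has the same size. *)
Lemma tie_case : #|F| = #|G| -> F = G \/ F = G0' n k.
Proof.
move=> cF; have [A0 /andP[A0F /eqP cA0]|none] := pickP [pred A in F | #|A| == a].
  right; have an : a <= n by lia. have mn : m <= n by lia.
  have botF (A : {set 'I_n}) : #|A| = a -> A \in F.
    by move=> cA; rewrite (bottom_level_const cA cA0).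
  have topF (A : {set 'I_n}) : #|A| = m -> A \notin F.
    move=> cA; have /card_gt0P[s] := cnt_gt0 A; rewrite inE => /eqP ->.
    by rewrite cA -bottom_xor_top botF // card_prefix_set.
  apply/setP=> A; rewrite [RHS]inE.
  have [AF|AF] := boolP (A \in F); apply/esym.
    have neq : #|A| <> m by move=> /topF; rewrite AF.
    have [|/(extra AF) cA] := boolP (A \in G); last by rewrite cA; lia.
    by rewrite mem_G0; move: #|A| neq => x; lia.
  have neq : #|A| <> a by move=> /botF; rewrite (negPf AF).
  apply: contraNF AF => le; apply: contraT => AF.
  have AG : A \in G by rewrite mem_G0; move: #|A| neq le => x; lia.
  by have := missed AG AF; move: #|A| le => x; lia.
left; apply/eqP; rewrite eqEcard cF leqnn andbT; apply/subsetP=> A AF.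
apply: contraT => /(extra AF) cA; have := none A.
by rewrite /= AF cA eqxx.
Qed.
End Tie.

Lemma card_G0' : n = m + a -> #|G0' n k| = #|G|.
Proof.
move=> ena; rewrite -(card_imset _ (@setC_inj 'I_n)); apply: eq_card => A.
rewrite mem_setC_imset mem_G0 inE cardsC_n; have := card_le_n A.
by move: #|A| => x; lia.
Qed.
End MiddleLevels.

(** * The bound and its equality case for large [n] *)

Section Bounds.
Variables (n k : nat) (F : {set {set 'I_n}}).
Hypothesis spF : pred_trace_sperner k F.
Hypotheses (k1 : 1 < k) (kn : 4 * k < n).
Local Notation a := ((n - (k - 1)) %/ 2).
Local Notation m := (a + k - 1).
Local Notation M := (middle k F).
Local Notation G := (G0 n k).

Lemma card_outside : #|F :\: M| <= 4 * k * n ^ (2 * k).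
Proof.
pose low := [set A : {set 'I_n} | #|A| < 2 * k].
have cl : #|low| <= 2 * k * n ^ (2 * k).
  by have := @card_small_sets 'I_n (2 * k); rewrite card_ord; apply; lia.
apply: (@leq_trans (#|low :|: @setC _ @: low|)).
  apply: subset_leq_card; apply/subsetP=> A /setDP[AF]; rewrite inE AF /= => nA.
  rewrite inE mem_setC_imset !inE cardsC_n; move: #|A| (card_le_n A) nA => x; lia.
apply: leq_trans (leq_card_setU _ _) _; rewrite card_imset; last exact: setC_inj.
by move: #|low| cl => x; lia.
Qed.

Lemma bin_outside_middle S : S \in F :\: M -> 'C(n, #|S|) <= n ^ (2 * k).
Proof.
move=> /setDP[SF]; rewrite inE SF /= => nS.
have [lt|ge] := ltnP #|S| (2 * k).
  by apply: leq_trans (leq_bin_exp _ _) _; rewrite leq_pexp2l ?(ltnW lt) //; lia.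
rewrite ge /= -ltnNge in nS.
rewrite -bin_sub ?card_le_n //; apply: leq_trans (leq_bin_exp _ _) _.
by rewrite leq_pexp2l; move: #|S| nS => x; lia.
Qed.

Hypothesis large : 8 * (4 * k * n ^ (2 * k)) * n ^ (2 * k) < 2 ^ a.

(** By [outside_deficit] and [exchange_G0], a set [S] outside [M] keeps [#|M|] below [#|G|] by at
    least ['C(n, m) / (8 * 'C(n, #|S|))], which by [large] exceeds the number of sets outside
    [M]. *)
Lemma outside_lt : F :\: M != set0 -> #|F| < #|G|.
Proof.
move=> /set0Pn[S SFM]; have WS := outside_deficit spF k1 kn SFM.
have [X _] := exchange_G0 k1 kn M; rewrite (weight_G0 k1 kn) in X.
have C0 : 0 < 'C(n, #|S|) by rewrite bin_gt0 card_le_n.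
have step : 8 * #|M| * n`! + 'C(n, m) * cnt S <= 8 * #|G| * n`!.
  by have := leq_mul (leqnn 'C(n, m)) WS; lia.
have {step}step : 8 * #|M| * 'C(n, #|S|) + 'C(n, m) <= 8 * #|G| * 'C(n, #|S|).
  rewrite -(leq_pmul2r (fact_gt0 n)).
  have := congr1 (muln 'C(n, m)) (cnt_bin S).
  by have := leq_mul step (leqnn 'C(n, #|S|)); lia.
have small : 8 * #|F :\: M| * 'C(n, #|S|) < 'C(n, m).
  apply: leq_trans (exp2_leq_bin k1 kn); apply: leq_ltn_trans large.
  by apply: leq_mul (bin_outside_middle SFM); rewrite leq_mul2l card_outside orbT.
have cF : #|F| = #|M| + #|F :\: M|.
  by rewrite -(cardsID M F) (setIidPr (middle_sub k F)).
rewrite -(ltn_pmul2r C0) -(@ltn_pmul2l 8) // cF.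
by move: step small; lia.
Qed.

(** Once [F = M], the LYM bound and [exchange_G0] give the inequality. Equality confines the
    differences between [F] and [G] to levels whose binomial coefficient is ['C(n, m)]. *)
Lemma card_le_G0 : #|F| <= #|G| ?= iff ((F == G) || odd (n + k) && (F == G0' n k)).
Proof.
have [D0|/set0Pn D0] := eqVneq (F :\: M) set0; last first.
  have lt : #|F| < #|G| by apply: outside_lt; apply/set0Pn.
  split; first exact: ltnW.
  rewrite (ltn_eqF lt); apply/esym/negbTE; apply/negP=> /orP[/eqP eF|/andP[o /eqP eF]].
    by rewrite eF ltnn in lt.
  by rewrite eF card_G0' ?ltnn // in lt; lia.
have FM : M = F.
  by apply/eqP; rewrite eqEsubset middle_sub -setD_eq0 D0 eqxx.
have WF : weight F <= weight G.
  by have := middle_weight spF k1 kn; rewrite FM (weight_G0 k1 kn).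
have [X eqX] := exchange_G0 k1 kn F.
have c0 : 0 < 'C(n, m) by apply: leq_trans (exp2_leq_bin k1 kn); rewrite expn_gt0.
have n0 := fact_gt0 n.
have le : #|F| <= #|G|.
  rewrite -(leq_pmul2r n0); have := leq_mul (leqnn 'C(n, m)) WF; lia.
split=> //; apply/eqP/orP => [eqc|[/eqP->//|/andP[o /eqP->]]]; last first.
  by rewrite card_G0' //; lia.
rewrite eqc leq_add2l leq_pmul2l // in X.
have eqW : weight F = weight G by apply/eqP; rewrite eqn_leq WF X.
rewrite eqc eqW eqxx in eqX.
have diff A : (A \in F) (+) (A \in G) -> 'C(n, #|A|) = 'C(n, m).
  by move=> dA; have /forallP/(_ A) := esym eqX; rewrite dA => /eqP.
have extra A : A \in F -> A \notin G -> #|A| = a /\ n = m + a.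
  move=> AF AG; have := diff A; rewrite AF (negPf AG) => /(_ isT) eqb.
  have := bin_outside k1 kn (card_le_n A); rewrite -mem_G0 // AG => /(_ isT) [_].
  by rewrite eqb eqxx => /esym/andP[/eqP ? /eqP ?].
have missed A : A \in G -> A \notin F -> #|A| = m \/ #|A| = n - m.
  move=> AG AF; have := diff A; rewrite AG (negPf AF) => /(_ isT) eqb.
  have := @bin_inside n k k1 kn #|A|; rewrite -mem_G0 // AG => /(_ isT) [_].
  by rewrite eqb eqxx => /esym/orP[/eqP ->|/eqP ->]; [left|right].
have [ena|ena] := n_cases k1 kn; last first.
  (* Here level [a] is strictly smaller than level [m], so [F] has no set outside [G]. *)
  left; rewrite eqEcard eqc leqnn andbT; apply/subsetP=> A AF.
  by apply: contraT => /(extra A AF) [_ ena']; lia.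
have [||||->|->] := @tie_case n k k1 kn F ena.
- by move=> s; rewrite -FM; apply: middle_tight => //; rewrite FM eqW weight_G0.
- move=> A AG AF; case: (missed A AG AF) => // cA; move: AG.
  by rewrite mem_G0 // cA; lia.
- by move=> A AF AG; case: (extra A AF AG).
- exact: eqc.
- by left.
- by right; rewrite eqxx andbT; lia.
Qed.
End Bounds.

Theorem theorem1p3 (k : nat) (hk : 2 <= k) :
  exists n0 : nat, forall n : nat, n0 <= n ->
  forall F : {set {set 'I_n}}, pred_trace_sperner k F ->
    #|F| <= Sigma n (k - 1) /\
    (#|F| = Sigma n (k - 1) <->
       F = G0 n k \/ (odd (n + k) /\ F = G0' n k)).
Proof.
(* The factor 32 is [8 * 4], and [n <= (k+2)(a+1)] turns [n^(4k)] into a power of [a + 1]. *)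
have [N NP] := poly_lt_exp (32 * k * (k + 2) ^ (4 * k)) (4 * k).
(* Large enough for both [N <= a] and [4 * k < n]. *)
exists (2 * N + 5 * k) => n len F spF.
have kn : 4 * k < n by lia.
have large : 8 * (4 * k * n ^ (2 * k)) * n ^ (2 * k) < 2 ^ ((n - (k - 1)) %/ 2).
  set a := (n - (k - 1)) %/ 2.
  apply: leq_ltn_trans (NP a _); last by rewrite /a; lia.
  have -> : 8 * (4 * k * n ^ (2 * k)) * n ^ (2 * k) = 32 * k * n ^ (4 * k).
    by rewrite (_ : 4 * k = 2 * k + 2 * k) ?expnD; lia.
  rewrite -[X in _ <= X]mulnA -expnMn leq_mul2l leq_exp2r ?orbT //; last lia.
  by apply/orP; right; rewrite /a; nia.
have [le eqF] := card_le_G0 spF hk kn large.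
rewrite -card_G0 //; split=> //; split=> [/eqP|].
  by rewrite eqF => /orP[/eqP|/andP[o /eqP]]; [left|right].
move=> eF; apply/eqP; rewrite eqF.
by case: eF => [->|[-> ->]]; rewrite eqxx ?orbT.
Qed.
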